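(* Let $\mathcal K_0$ be a Fraïssé class in a signature $L_0$, let $L=L_0\cup\{<\}$, and let $\mathcal K,\mathcal K'$ be reasonable Fraïssé order classes in $L$ that are expansions of $\mathcal K_0$. If $\mathcal K$ satisfies the Ramsey property and $\mathcal K'$ satisfies both the Ramsey and ordering properties, then $\mathcal K'\subseteq\mathcal K$ up to simple bi-definability, i.e., there is a reasonable Fraïssé order class $\mathcal K''$ in $L$ which is an expansion of $\mathcal K_0$ such that $\mathcal K''\subseteq\mathcal K$ and $\mathcal K''$ is simply bi-definable with $\mathcal K'$.
   Context: Fraïssé classes: classes of finite structures closed under isomorphism, countably many isomorphism types, arbitrarily large finite members, hereditary, joint embedding and amalgamation properties; order class: $<$ always a linear order. Expansion of $\mathcal K_0$: a class $\mathcal K$ of $L$-structures with $\mathcal K|L_0=\mathcal K_0$ (reducts forgetting $<$); $\langle\boldsymbol A_0,\prec\rangle$ is the expansion interpreting $<$ as $\prec$. Reasonable: for every embedding $\pi:\boldsymbol A_0\to\boldsymbol B_0$ in $\mathcal K_0$ and linear order $\prec$ on $A_0$ with $\langle\boldsymbol A_0,\prec\rangle\in\mathcal K$, there is $\prec'$ on $B_0$ with $\langle\boldsymbol B_0,\prec'\rangle\in\mathcal K$ and $\pi$ an embedding of the expansions. Ramsey property: hereditary and for all $\boldsymbol A\le\boldsymbol B$ in the class, $k\ge2$, there is $\boldsymbol C$ in the class, $\boldsymbol B\le\boldsymbol C$, such that every $k$-coloring of copies of $\boldsymbol A$ in $\boldsymbol C$ is constant on copies of $\boldsymbol A$ inside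 some copy of $\boldsymbol B$ in $\boldsymbol C$. Ordering property: for each $\boldsymbol A_0\in\mathcal K_0$ there is $\boldsymbol B_0\in\mathcal K_0$ such that every expansion of $\boldsymbol A_0$ in the class embeds in every expansion of $\boldsymbol B_0$ in the class. Simple formula: quantifier-free formula of $L_{\omega_1\omega}$ (atomic formulas closed under negation, countable conjunction and disjunction). Two expansions $\mathcal K,\mathcal K'$ of $\mathcal K_0$ are simply bi-definable if there are simple $L$-formulas $\varphi(x,y),\varphi'(x,y)$ such that for every $\boldsymbol A_0\in\mathcal K_0$, sending $\boldsymbol A=\langle\boldsymbol A_0,\prec\rangle\in\mathcal K$ to $\langle\boldsymbol A_0,\prec'\rangle$ with $a\prec' b\Leftrightarrow\boldsymbol A\models\varphi[a,b]$ is a bijection from the expansions of $\boldsymbol A_0$ in $\mathcal K$ to those in $\mathcal K'$, whose inverse is given in the same way by $\varphi'$. *)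

(* Defs.v *)
From mathcomp Require Import all_boot.
From mathcomp Require Import boolp classical_sets functions.

Set Implicit Arguments.
Unset Strict Implicit.
Unset Printing Implicit Defensive.

Record signature := Signature {
  rel_sym : Type;
  rel_arity : rel_sym -> nat;
  fun_sym : Type;
  fun_arity : fun_sym -> nat
}.

(* Finite, nonempty structures. *)
Record structure (L : signature) := Structure {
  carrier :> finType;
  carrier_gt0 : 0 < #|carrier|;
  rel_interp : forall R : rel_sym L, (rel_arity R).-tuple carrier -> bool;
  fun_interp : forall f : fun_sym L, (fun_arity f).-tuple carrier -> carrier
}.
Arguments rel_interp {L} A R _ : rename.
Arguments fun_interp {L} A f _ : rename.

Section Classes.
Variable L : signature.
Implicit Types (A B C D : structure L) (K : structure L -> Prop).

Definition embedding A B (h : A -> B) : Prop :=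
  [/\ injective h,
      forall (R : rel_sym L) (t : (rel_arity R).-tuple A),
        rel_interp B R (map_tuple h t) = rel_interp A R t &
      forall (f : fun_sym L) (t : (fun_arity f).-tuple A),
        h (fun_interp A f t) = fun_interp B f (map_tuple h t)].

Definition embeds A B : Prop := exists h : A -> B, embedding h.

Definition isomorphic A B : Prop :=
  exists2 h : A -> B, embedding h & bijective h.

Definition iso_closed K : Prop :=
  forall A B, isomorphic A B -> K A -> K B.

Definition countably_many_iso_types K : Prop :=
  exists E : nat -> structure L, forall A, K A -> exists n, isomorphic A (E n).

Definition arbitrarily_large K : Prop :=
  forall n : nat, exists2 A, K A & n <= #|A|.

Definition hereditary K : Prop :=
  forall A B, embeds A B -> K B -> K A.

Definition joint_embedding K : Prop :=
  forall A B, K A -> K B -> exists C, [/\ K C, embeds A C & embeds B C].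

Definition amalgamation K : Prop :=
  forall A B C (f : A -> B) (g : A -> C),
    K A -> K B -> K C -> embedding f -> embedding g ->
    exists D (r : B -> D) (s : C -> D),
      [/\ K D, embedding r, embedding s & forall a, r (f a) = s (g a)].

Definition fraisse_class K : Prop :=
  [/\ iso_closed K, countably_many_iso_types K & arbitrarily_large K] /\
  [/\ hereditary K, joint_embedding K & amalgamation K].

(* A copy of A in C is a substructure of C isomorphic to A, i.e. the image of
   an embedding of A; it is represented by its universe. *)
Definition copy A C (X : {set C}) : Prop :=
  exists2 h : A -> C, embedding h & X = [set h a | a in A].

(* A colouring is given as a function on all subsets of C; only its values on
   copies of A matter. *)
Definition ramsey_property K : Prop :=
  hereditary K /\
  forall A B (k : nat), K A -> K B -> embeds A B -> 2 <= k ->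
    exists C, [/\ K C, embeds B C &
      forall c : {set C} -> 'I_k,
        exists2 Y : {set C}, copy B Y &
          exists i : 'I_k,
            forall X : {set C}, copy A X -> X \subset Y -> c X = i].

End Classes.

Section Orders.
Variable L : signature.

(* L together with one new binary relation symbol <, namely None. *)
Definition ord_sig : signature := {|
  rel_sym := option (rel_sym L);
  rel_arity := fun R => if R is Some R0 then rel_arity R0 else 2;
  fun_sym := fun_sym L;
  fun_arity := @fun_arity L
|}.

Definition reduct (A : structure ord_sig) : structure L :=
  @Structure L A (carrier_gt0 A)
    (fun R => rel_interp A (Some R : rel_sym ord_sig))
    (fun f => fun_interp A (f : fun_sym ord_sig)).

Definition expand (A : structure L) (r : rel A) : structure ord_sig :=
  @Structure ord_sig A (carrier_gt0 A)
    (fun R : rel_sym ord_sig =>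
       match R return (@rel_arity ord_sig R).-tuple A -> bool with
       | Some R0 => rel_interp A R0
       | None => fun t => r (tnth t ord0) (tnth t ord_max)
       end)
    (fun f : fun_sym ord_sig => fun_interp A (f : fun_sym L)).

Definition lt_of (A : structure ord_sig) : rel A :=
  fun a b => rel_interp A (None : rel_sym ord_sig) [tuple a; b].

Definition linear_order (T : Type) (r : rel T) : Prop :=
  [/\ irreflexive r, transitive r & forall a b : T, [\/ a = b, r a b | r b a]].

Implicit Types K : structure ord_sig -> Prop.

Definition order_class K : Prop := forall A, K A -> linear_order (@lt_of A).

(* The reducts of members of K are exactly the members of K0; the structures
   with reduct A0 are the expand A0 r. *)
Definition expansion_of (K0 : structure L -> Prop) K : Prop :=
  (forall A, K A -> K0 (reduct A)) /\
  (forall A0, K0 A0 -> exists r : rel A0, K (expand r)).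

Definition reasonable (K0 : structure L -> Prop) K : Prop :=
  forall (A0 B0 : structure L) (p : A0 -> B0) (r : rel A0),
    K0 A0 -> K0 B0 -> embedding p -> linear_order r -> K (expand r) ->
    exists r' : rel B0,
      [/\ linear_order r', K (expand r') &
          @embedding ord_sig (expand r) (expand r') p].

Definition ordering_property (K0 : structure L -> Prop) K : Prop :=
  forall A0 : structure L, K0 A0 ->
    exists2 B0 : structure L, K0 B0 &
      forall (r : rel A0) (r' : rel B0),
        K (expand r) -> K (expand r') -> embeds (expand r) (expand r').

End Orders.

Section SimpleFormulas.
Variables (L : signature) (V : Type).

Inductive term : Type :=
| Var of V
| App (f : fun_sym L) of ('I_(fun_arity f) -> term).

(* Quantifier-free formulas of L_{omega_1 omega} with variables in V. *)
Inductive simple_formula : Type :=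
| Equal of term & term
| Rel (R : rel_sym L) of ('I_(rel_arity R) -> term)
| Neg of simple_formula
| Conj of (nat -> simple_formula)
| Disj of (nat -> simple_formula).

Fixpoint eval (A : structure L) (v : V -> A) (t : term) : A :=
  match t with
  | Var x => v x
  | App f ts => fun_interp A f [tuple eval v (ts i) | i < fun_arity f]
  end.

Fixpoint sat (A : structure L) (v : V -> A) (phi : simple_formula) : Prop :=
  match phi with
  | Equal t u => eval v t = eval v u
  | Rel R ts => rel_interp A R [tuple eval v (ts i) | i < rel_arity R]
  | Neg psi => ~ sat v psi
  | Conj psi => forall n, sat v (psi n)
  | Disj psi => exists n, sat v (psi n)
  end.

End SimpleFormulas.

Section Bidefinability.
Variable L : signature.
Implicit Types K : structure (ord_sig L) -> Prop.

(* Formulas phi(x, y): x and y are the variables 0 and 1 of 'I_2. *)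
Definition defined_order (phi : simple_formula (ord_sig L) 'I_2)
    (A0 : structure L) (r : rel A0) : rel A0 :=
  fun a b => `[< @sat _ _ (expand r) (tnth [tuple a; b]) phi >].

Definition expansions K (A0 : structure L) : set (rel A0) :=
  [set r : rel A0 | K (expand r)]%classic.
Arguments expansions K A0 : clear implicits.

Definition simply_bidefinable (K0 : structure L -> Prop) K K' : Prop :=
  exists phi phi' : simple_formula (ord_sig L) 'I_2,
    forall A0 : structure L, K0 A0 ->
      set_bij (expansions K A0) (expansions K' A0) (@defined_order phi A0) /\
      (forall r : rel A0, expansions K A0 r ->
         defined_order phi' (defined_order phi r) = r).

End Bidefinability.

(* Main.v *)
(* Call a map sending each [<A0, r>] in [K] to an order on [A0], compatibly with
   all embeddings, natural. If [K] is Ramsey, colouring the copies of [A] in a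
   large [C] by the restriction of an arbitrary [K']-order on [C] makes that
   order depend only on the isomorphism type of [A], for finitely many [A] at a
   time; an ultrafilter limit then yields a natural map from [K] to [K']. So
   there are natural maps [F : K -> K'] and [H : K' -> K], and the ordering
   property forces the natural map [F \o H] to permute the [K']-expansions of
   each [A0]. The class [K''] is the image of [H]: on it [F] is a natural
   bijection onto [K'], which transports the Fraisse properties. Natural maps are
   given by simple formulas, because pairs satisfying the same simple formulas
   generate isomorphic substructures and there are only countably many pairs up
   to isomorphism. *)
Require Import Defs.
From mathcomp Require Import all_boot.
From mathcomp Require Import boolp classical_sets filter.

Set Implicit Arguments.
Unset Strict Implicit.
Unset Printing Implicit Defensive.

(** * Embeddings and isomorphisms of finite structures *)

Section Embeddings.
Variable L : signature.
Implicit Types A B C : structure L.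

Lemma embedding_id A : @embedding L A A id.
Proof.
have mapid n (t : n.-tuple A) : map_tuple id t = t.
  by apply: val_inj => /=; rewrite map_id.
by split=> // [R|f] t; rewrite mapid.
Qed.

Lemma embedding_comp A B C (g : B -> C) (f : A -> B) :
  embedding g -> embedding f -> embedding (g \o f).
Proof.
have mapc n (t : n.-tuple A) : map_tuple (g \o f) t = map_tuple g (map_tuple f t).
  by apply: val_inj => /=; rewrite map_comp.
move=> [gi gr gf] [fi fr ff]; split=> [|R t|s t]; first exact: inj_comp.
  by rewrite mapc gr fr.
by rewrite mapc /= ff gf.
Qed.

Lemma embedding_inv A B (f : A -> B) (g : B -> A) :
  embedding f -> cancel f g -> cancel g f -> embedding g.
Proof.
move=> [fi fr ff] fK gK.
have mapK n (t : n.-tuple B) : map_tuple f (map_tuple g t) = t.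
  by apply: val_inj => /=; rewrite mapK.
split=> [|R t|s t]; first exact: can_inj gK.
  by rewrite -fr mapK.
by apply: fi; rewrite gK ff mapK.
Qed.

Lemma isomorphic_sym A B : isomorphic A B -> isomorphic B A.
Proof.
case=> f fe [g fK gK]; exists g; first exact: embedding_inv fe fK gK.
by exists f.
Qed.

Lemma isomorphic_embeds A B : isomorphic A B -> embeds A B.
Proof. by case=> f fe _; exists f. Qed.

Lemma hereditary_iso_closed (K : structure L -> Prop) :
  hereditary K -> iso_closed K.
Proof. by move=> hK A B /isomorphic_sym/isomorphic_embeds; apply: hK. Qed.

End Embeddings.

(** * Ordered expansions and their reducts *)

Section Expansions.
Variable L : signature.
Implicit Types (A B : structure (ord_sig L)) (M N : structure L).

Lemma embedding_ordP A B (h : A -> B) :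
  embedding h <->
  @embedding L (reduct A) (reduct B) h /\
  forall a b, lt_of (h a) (h b) = lt_of a b.
Proof.
split=> [[hi hr hf]|[[hi hr hf] hlt]].
  split=> [|a b]; first by split=> // R t; exact: (hr (Some R)).
  rewrite -[RHS](hr None); congr rel_interp; exact: val_inj.
split=> // -[R|] t; first exact: (hr R).
have tE (T : Type) (u : 2.-tuple T) : u = [tuple tnth u ord0; tnth u ord_max].
  move: u => [] [|x [|y [|//]]] //= i; exact: val_inj.
move: (hlt (tnth t ord0) (tnth t ord_max)).
rewrite /lt_of -tE => <-; congr rel_interp.
by apply: val_inj; rewrite {1}(tE _ t).
Qed.

Lemma lt_of_expand M (r : rel M) : @lt_of L (expand r) = r.
Proof. by apply/funext => a; apply/funext. Qed.

Lemma embedding_expandP M N (r : rel M) (s : rel N) (h : M -> N) :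
  @embedding _ (expand r) (expand s) h <->
  embedding h /\ forall a b, s (h a) (h b) = r a b.
Proof.
rewrite embedding_ordP !lt_of_expand.
by split=> -[[hi hr hf] hlt].
Qed.

Lemma embedding_relpre M N (s : rel N) (h : M -> N) :
  embedding h -> @embedding _ (expand (relpre h s)) (expand s) h.
Proof. by move=> he; apply/embedding_expandP. Qed.

Lemma expand_lt_of A : @expand L (reduct A) (@lt_of L A) = A.
Proof.
case: A => c c0 ri fi; rewrite /expand /=; congr Structure.
apply/functional_extensionality_dep => -[R|] //=.
apply/funext => -[] [|x [|y [|//]]] //= i.
by rewrite /lt_of /=; congr ri; apply: val_inj.
Qed.

(** Natural maps act on an unordered structure together with an order; this principle presents every
    ordered structure in that form. *)
Lemma expand_ind (P : structure (ord_sig L) -> Prop) :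
  (forall M (r : rel M), P (expand r)) -> forall A, P A.
Proof. by move=> H A; rewrite -(expand_lt_of A). Qed.

Lemma reduct_expand M (r : rel M) : reduct (expand r) = M.
Proof. by case: M r. Qed.

End Expansions.

(** * Homogeneous copies for an arbitrary binary relation *)

Section Ramsey.
Variable L : signature.
Implicit Types A B C : structure (ord_sig L).

(* Both [h a] and [h' a] are the element of the common image whose rank is the
   rank of [a]. *)
Lemma embedding_eq_image A C (h h' : A -> C) :
  linear_order (@lt_of L C) -> embedding h -> embedding h' ->
  [set h a | a in A] = [set h' a | a in A] -> h =1 h'.
Proof.
move=> [irrC trC totC] he he' im_h a.
pose X := [set h a | a in A].
have rank (k : A -> C) : embedding k -> X = [set k a | a in A] ->
    #|[set y in X | lt_of y (k a)]| = #|[set b | @lt_of L A b a]|.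
  move=> /[dup] -[ki _ _] /embedding_ordP[_ klt] ->; rewrite -(card_imset _ ki).
  apply: eq_card => y; rewrite inE; apply/andP/imsetP.
    by case=> /imsetP[b _ ->]; rewrite klt => ba; exists b; rewrite ?inE.
  by case=> b; rewrite inE => ba ->; rewrite klt imset_f.
have lt_rank x y : x \in X -> lt_of x y ->
    (#|[set z in X | lt_of z x]| < #|[set z in X | lt_of z y]|)%N.
  move=> xX xy; apply/proper_card/properP; split.
    by apply/fintype.subsetP => z; rewrite !inE => /andP[-> /trC->].
  by exists x; rewrite !inE xX //= irrC.
have haX : h a \in X by rewrite imset_f.
have h'aX : h' a \in X by rewrite /X im_h imset_f.
have eq_rank := rank h he erefl; rewrite -(rank h' he' im_h) in eq_rank.
case: (totC (h a) (h' a)) => // /lt_rank.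
  by rewrite eq_rank ltnn => /(_ haX).
by rewrite eq_rank ltnn => /(_ h'aX).
Qed.

Variable K : structure (ord_sig L) -> Prop.
Hypotheses (K_order : order_class K) (K_ramsey : ramsey_property K).

(** A copy of [A] in [C] is coloured by the relation that [s] induces on [A]. By
    [embedding_eq_image] a copy is the image of only one embedding, so this colour is well
    defined. *)
Lemma ramsey_rel A B : K A -> K B ->
  exists2 C, K C & forall s : rel C, exists2 e : B -> C, embedding e &
    forall f g : A -> B, embedding f -> embedding g ->
    forall a b, s (e (f a)) (e (f b)) = s (e (g a)) (e (g b)).
Proof.
move=> KA KB; have [AB|nAB] := EM (embeds A B); last first.
  exists B => // s; exists id; first exact: embedding_id.
  by move=> f g fe; case: nAB; exists f.
(* One colour for each binary relation on [A]; there are at least two because [A] is nonempty. *)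
pose k := #|{: {ffun A * A -> bool}}|.
have k2 : 1 < k.
  rewrite /k card_ffun card_bool card_prod -[1]/(2 ^ 0)%N ltn_exp2l //.
  by rewrite muln_gt0 carrier_gt0.
have [C [KC _ ramC]] := K_ramsey.2 A B k KA KB AB k2.
exists C => // s; pose pull (h : A -> C) := [ffun p : A * A => s (h p.1) (h p.2)].
have col (X : {set C}) : exists i : 'I_k, forall h : A -> C, embedding h ->
    X = [set h a | a in A] -> i = enum_rank (pull h).
  have [[h he Xh]|nX] := EM (copy A X); last first.
    (* Sets that are not copies of [A] get an arbitrary colour. *)
    by exists (enum_rank [ffun=> false]) => h he Xh; case: nX; exists h.
  exists (enum_rank (pull h)) => h' he' Xh'; congr enum_rank.
  apply/ffunP => p; rewrite !ffunE.
  have hh' := embedding_eq_image (K_order KC) he he' (etrans (esym Xh) Xh').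
  by rewrite !hh'.
have [c cP] := choice col; have [Y [e ee YE] [i ci]] := ramC c.
exists e => // f g fe ge a b.
have pullE (h : A -> B) : embedding h -> pull (e \o h) = enum_val i.
  move=> he; have ehe := embedding_comp ee he.
  rewrite -(ci [set (e \o h) a | a in A]).
  - by rewrite (cP _ _ ehe erefl) enum_rankK.
  - by exists (e \o h).
  - by rewrite YE; apply/fintype.subsetP => _ /imsetP[x _ ->] /=; rewrite imset_f.
have := pullE g ge; rewrite -(pullE f fe) => /ffunP/(_ (a, b)).
by rewrite !ffunE.
Qed.

(** At each step the previous [C] is placed homogeneously for [E N] inside a larger [D]. Pulling [s]
    back to [C] then gives homogeneity for the earlier structures, and that for [E N] is kept
    because [e \o f] and [e \o g] embed [E N] in [C]. *)
Lemma ramsey_rel_seq (E : nat -> structure (ord_sig L)) N B : K B ->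
  exists2 C, K C & forall s : rel C, exists2 e : B -> C, embedding e &
    forall n, n < N -> K (E n) ->
    forall f g : E n -> B, embedding f -> embedding g ->
    forall a b, s (e (f a)) (e (f b)) = s (e (g a)) (e (g b)).
Proof.
move=> KB; elim: N => [|N [C KC sC]].
  by exists B => // s; exists id => //; exact: embedding_id.
have [KE|nKE] := EM (K (E N)); last first.
  exists C => // s; have [e ee eP] := sC s; exists e => // n.
  by rewrite ltnS leq_eqVlt => /orP[/eqP->//|]; exact: eP.
have [D KD sD] := ramsey_rel KE KC; exists D => // s.
have [d de dP] := sD s; have [e ee eP] := sC (relpre d s).
exists (d \o e); first exact: embedding_comp.
move=> n; rewrite ltnS leq_eqVlt => /orP[/eqP->|nN] KEn f g fe ge a b.
  by apply: (dP (e \o f) (e \o g)); exact: embedding_comp.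
exact: (eP n nN KEn).
Qed.

End Ramsey.

(** * Existence of natural maps out of a Ramsey class *)

Section NaturalMaps.
Variable L : signature.
Implicit Types K : structure (ord_sig L) -> Prop.

(* A natural map on [K] is the finitary form of an order on the Fraisse limit
   of [K0] that is invariant under the automorphisms of the limit of [K]. *)
Definition natural K (F : forall M : structure L, rel M -> rel M) : Prop :=
  forall (M N : structure L) (r : rel M) (s : rel N) (h : M -> N),
    K (expand r) -> K (expand s) -> @embedding _ (expand r) (expand s) h ->
    forall a b, F N s (h a) (h b) = F M r a b.

Definition maps_class K K' (F : forall M : structure L, rel M -> rel M) : Prop :=
  forall (M : structure L) (r : rel M), K (expand r) -> K' (expand (F M r)).

Variables K0 : structure L -> Prop.
Variables K K' : structure (ord_sig L) -> Prop.
Hypotheses (K_fraisse : fraisse_class K) (K_order : order_class K).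
Hypotheses (K_expansion : expansion_of K0 K) (K_ramsey : ramsey_property K).
Hypotheses (K'_hereditary : hereditary K') (K'_expansion : expansion_of K0 K').

(** A natural map restricted to the first [N] terms of an enumeration. The family [o] is indexed by
    all [n], so that families for different [N] can be compared in the limit. *)
Let natural_on (E : nat -> structure (ord_sig L)) N (o : forall n, rel (E n)) :=
  (forall n, n < N -> K (E n) -> K' (@expand L (reduct (E n)) (o n))) /\
  (forall m n (h : E m -> E n), m < N -> n < N -> K (E m) -> K (E n) ->
     embedding h -> forall a b, o n (h a) (h b) = o m a b).

(** Joint embedding puts the relevant [E n] into one [D], and [D] into a [C] whose reduct carries
    some order [s] from [K']. On a homogeneous copy of [D], restricting [s] along any embedding of
    [E n] gives the same order; naturality follows by composing embeddings. *)
Lemma natural_finite (E : nat -> structure (ord_sig L)) N :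
  exists o, @natural_on E N o.
Proof.
have [[_ _ large] [_ jep _]] := K_fraisse.
have [D KD ED] : exists2 D, K D & forall n, n < N -> K (E n) -> embeds (E n) D.
  elim: N => [|N [D KD ED]]; first by have [D KD _] := large 0; exists D.
  have [KE|nKE] := EM (K (E N)); last first.
    by exists D => // n; rewrite ltnS leq_eqVlt => /orP[/eqP->//|]; exact: ED.
  have [D' [KD' [h he] [k ke]]] := jep _ _ KD KE; exists D' => // n.
  rewrite ltnS leq_eqVlt => /orP[/eqP->|nN] KEn; first by exists k.
  by have [i ie] := ED n nN KEn; exists (h \o i); exact: embedding_comp.
have [C KC sC] := ramsey_rel_seq K_order K_ramsey E N KD.
have [s K's] := K'_expansion.2 _ (K_expansion.1 _ KC).
have [e ee eP] := sC s.
have oP n : exists o : rel (E n), n < N -> K (E n) ->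
    forall f : E n -> D, embedding f -> forall a b, o a b = s (e (f a)) (e (f b)).
  have [[f fe]|nED] := EM (embeds (E n) D); last first.
    by exists (fun _ _ => false) => _ _ f fe; case: nED; exists f.
  exists (relpre (e \o f) s) => nN KEn g ge a b; exact: (eP n nN KEn f g fe ge).
exists (fun n => projT1 (cid (oP n))); split=> [n nN KEn|m n h mN nN KEm KEn he a b].
  case: cid => o /= /(_ nN KEn) oE; have [f fe] := ED n nN KEn.
  have /embedding_ordP[efe _] := embedding_comp ee fe.
  have -> : o = relpre (e \o f) s.
    by apply/funext => a; apply/funext => b; rewrite (oE f fe).
  by apply: K'_hereditary K's; exists (e \o f); apply: embedding_relpre efe.
case: cid => on /= /(_ nN KEn) onE; case: cid => om /= /(_ mN KEm) omE.
have [f fe] := ED n nN KEn.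
by rewrite (onE f fe) (omE (f \o h) (embedding_comp fe he)).
Qed.

(** Each condition involves at most two indices. As each [E n] is finite, its limit order equals
    that of stage [N] for [U]-almost all [N], so every condition can be read off at a single late
    stage. *)
Lemma natural_countable (E : nat -> structure (ord_sig L)) :
  exists o, forall N, @natural_on E N o.
Proof.
have [oN oNP] := choice (natural_finite E).
(* [U] contains every set of all sufficiently large [N]. *)
have [U [ultraU ooU]] := ultraFilterLemma eventually_filter.
pose o n : rel (E n) := fun a b => `[< U [set N | oN N n a b]%classic >].
have oU n : U [set N | oN N n = o n]%classic.
  have : U [set N | forall p : E n * E n, oN N n p.1 p.2 = o n p.1 p.2]%classic.
    apply: filter_forall => -[a b] /=; rewrite /o.
    have [Uab|Uab] := in_ultra_setVsetC [set N | oN N n a b]%classic ultraU.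
      by rewrite asboolT //; apply: filterS Uab.
    rewrite asboolF.
      by apply: filterS Uab => N /= /negP/negbTE.
    move=> Uab'; apply: (@filter_not_empty _ U _).
    by rewrite -(setICr [set N | oN N n a b]%classic); apply: filterI.
  apply: filterS => N eqo; apply/funext => a; apply/funext => b; exact: (eqo (a, b)).
have pick m n : exists N, [/\ m < N, n < N, oN N m = o m & oN N n = o n].
  have : U ([set N | maxn m n < N] `&`
      ([set N | oN N m = o m] `&` [set N | oN N n = o n]))%classic.
    apply: filterI; last exact: filterI.
    by apply: ooU; exists (maxn m n).+1.
  move=> /filter_ex[N [/= +] [? ?]]; rewrite gtn_max => /andP[? ?].
  by exists N.
exists o => N0; split=> [n _ KEn|m n h _ _ KEm KEn he a b].
  by have [N [_ nN _ <-]] := pick n n; apply: (oNP N).1.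
have [N [mN nN <- <-]] := pick m n; exact: (oNP N).2.
Qed.

(** The orders on the representatives are transported along chosen isomorphisms. An embedding [h]
    becomes, after conjugation by these, an embedding between representatives, where naturality is
    known. *)
Lemma natural_map_exists : exists F, natural K F /\ maps_class K K' F.
Proof.
have [[isoK [E EP] _] _] := K_fraisse.
have [o oP] := natural_countable E.
have GP (A : structure (ord_sig L)) : exists r : rel A, K A ->
    exists n (i : A -> E n) j, [/\ K (E n), embedding i, cancel i j, cancel j i &
      r = relpre i (o n)].
  have [KA|nKA] := EM (K A); last by exists (fun _ _ => false).
  have [n AE] := EP _ KA; have KE := isoK _ _ AE KA.
  by case: AE => i ie [j ij ji]; exists (relpre i (o n)) => _; exists n, i, j.
pose G A := projT1 (cid (GP A)).
have GE A : K A -> exists n (i : A -> E n) j, [/\ K (E n), embedding i, cancel i j,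
    cancel j i & G A = relpre i (o n)] by rewrite /G; case: cid.
exists (fun M r => G (expand r)); split.
  move=> M N r s h Kr Ks he a b.
  have [m [i [j [KEm ie ij ji ->]]]] := GE _ Kr.
  have [n [i' [j' [KEn ie' ij' ji' ->]]]] := GE _ Ks.
  have je := embedding_inv ie ij ji.
  have ce := embedding_comp (embedding_comp ie' he) je.
  have := (oP (maxn m n).+1).2 _ _ _ _ _ KEm KEn ce (i a) (i b).
  rewrite !ltnS leq_maxl leq_maxr /= !ij; exact.
move=> M r Kr; have [n [i [j [KEn ie _ _ ->]]]] := GE _ Kr.
have K'n := (oP n.+1).1 n (ltnSn n) KEn.
apply: K'_hereditary K'n; exists i; apply: embedding_relpre.
by case/embedding_ordP: ie => -[].
Qed.

End NaturalMaps.

(** * Simple formulas: generated substructures and separation *)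

Section SimpleFormulaTheory.
Variables (L : signature) (V : Type).
Implicit Types A B C : structure L.

Lemma eval_embedding A B (h : A -> B) (v : V -> A) (t : term L V) :
  embedding h -> eval (h \o v) t = h (eval v t).
Proof.
move=> [_ _ hf]; elim: t => //= f ts IH; rewrite hf; congr fun_interp.
by apply: eq_from_tnth => i; rewrite !tnth_map IH.
Qed.

Lemma sat_embedding A B (h : A -> B) (v : V -> A) (phi : simple_formula L V) :
  embedding h -> sat (h \o v) phi <-> sat v phi.
Proof.
move=> he; have [hi hr _] := he; elim: phi => /= [t u|R ts|psi IH|psi IH|psi IH].
- by rewrite !eval_embedding //; split=> [/hi|->].
- suff -> : [tuple eval (h \o v) (ts i) | i < rel_arity R] =
      map_tuple h [tuple eval v (ts i) | i < rel_arity R] by rewrite hr.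
  by apply: eq_from_tnth => i; rewrite !tnth_map eval_embedding.
- by split=> nsat /IH.
- by split=> + n => /(_ n)/IH.
- by split=> -[n /IH]; exists n.
Qed.

(** [C] is the substructure of [A] generated by [v], and [j] sends the value of a term at [v] to its
    value at [w]. Atomic formulas and their negations both transfer, which makes [j] well defined
    and an embedding. The variable [x] makes [C] nonempty. *)
Lemma sat_span A B (v : V -> A) (w : V -> B) (x : V) :
  (forall phi : simple_formula L V, sat v phi -> sat w phi) ->
  exists C (i : C -> A) (j : C -> B) (u : V -> C),
    [/\ embedding i, embedding j, i \o u =1 v & j \o u =1 w].
Proof.
move=> sat_vw.
have eq_vw t t' : eval w t = eval w t' -> eval v t = eval v t'.
  move=> wtt'; have [//|nvtt'] := EM (eval v t = eval v t').
  by have /= := sat_vw (Neg (Equal t t')) nvtt'.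
have rel_vw (R : rel_sym L) ts :
    rel_interp B R [tuple eval w (ts i) | i < rel_arity R] =
    rel_interp A R [tuple eval v (ts i) | i < rel_arity R].
  apply/idP/idP => [Bts|Ats]; last exact: (sat_vw (Rel ts) Ats).
  by apply: contrapT => nAts; exact: (sat_vw (Neg (Rel ts)) nAts Bts).
pose T := {a : A | `[< exists t, eval v t = a >]}.
(* A chosen term naming [c]; [jE] shows that [j] is independent of the choice. *)
pose tm (c : T) := projT1 (cid (asboolW (valP c))).
have tmE c : eval v (tm c) = val c by rewrite /tm; case: cid.
have map_valE n (t : n.-tuple T) :
    map_tuple val t = [tuple eval v (tm (tnth t i)) | i < n].
  by apply: eq_from_tnth => i; rewrite !tnth_map tnth_ord_tuple tmE.
have T_clos (f : fun_sym L) (t : (fun_arity f).-tuple T) :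
    `[< exists u, eval v u = fun_interp A f (map_tuple val t) >].
  by apply/asboolP; exists (App (fun i => tm (tnth t i))); rewrite map_valE.
have T_v y : `[< exists u, eval v u = v y >] by apply/asboolP; exists (Var L y).
have T_gt0 : 0 < #|{: T}| by apply/card_gt0P; exists (Sub (v x) (T_v x) : T).
pose C := @Structure L {: T} T_gt0 (fun R t => rel_interp A R (map_tuple val t))
  (fun f t => (Sub (fun_interp A f (map_tuple val t)) (T_clos f t) : T)).
pose j (c : C) := eval w (tm c).
have jE (c : C) t : val c = eval v t -> j c = eval w t.
  by rewrite -tmE => vt; exact: (sat_vw (Equal _ _) vt).
have map_jE n (t : n.-tuple C) :
    map_tuple j t = [tuple eval w (tm (tnth t i)) | i < n].
  by apply: eq_from_tnth => i; rewrite !tnth_map tnth_ord_tuple.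
exists C, val, j, (fun y => Sub (v y) (T_v y) : T); split=> //.
- by split=> //; exact: val_inj.
- split=> [c c' /eq_vw|R t|f t].
  + by rewrite !tmE; exact: val_inj.
  + by rewrite map_jE rel_vw -map_valE.
  + rewrite (jE _ (App (fun i => tm (tnth t i)))) /= ?map_jE //.
    by rewrite map_valE.
- by move=> y /=; rewrite (jE _ (Var L y)).
Qed.

(** The formula is the disjunction, over [t] in [P], of the conjunctions over [u] in [Q] of formulas
    separating [t] from [u]. Indices are coded by [pickle]; other positions hold [top] in
    conjunctions and [Neg top] in disjunctions. *)
Lemma separating_formula (T : countType) (A : T -> structure L)
    (v : forall t, V -> A t) (P Q : T -> Prop) (x : V) :
  (forall t u, P t -> Q u -> exists psi, sat (v t) psi /\ ~ sat (v u) psi) ->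
  exists phi, (forall t, P t -> sat (v t) phi) /\ (forall u, Q u -> ~ sat (v u) phi).
Proof.
move=> sep; pose top := Equal (Var L x) (Var L x).
have psiP (p : T * T) : exists psi, P p.1 -> Q p.2 ->
    sat (v p.1) psi /\ ~ sat (v p.2) psi.
  have [[Pt Qu]|nPQ] := EM (P p.1 /\ Q p.2).
    by have [psi ?] := sep _ _ Pt Qu; exists psi.
  by exists top => Pt Qu; case: nPQ.
have [psi {}psiP] := choice psiP.
pose conj t := Conj (fun n => if unpickle n is Some u then
  if `[< Q u >] then psi (t, u) else top else top).
exists (Disj (fun n => if unpickle n is Some t then
  if `[< P t >] then conj t else Neg top else Neg top)); split=> [t Pt|u Qu] /=.
  exists (pickle t); rewrite pickleK asboolT //= => n.
  case: unpickle => //= u; case: asboolP => //= Qu.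
  by have [] := psiP (t, u) Pt Qu.
case=> n; case: unpickle => [t|] /=; last exact.
case: asboolP => [Pt|_] /=; last exact.
move=> /(_ (pickle u)); rewrite pickleK asboolT //.
by have [] := psiP (t, u) Pt Qu.
Qed.

End SimpleFormulaTheory.

(** * Natural maps are given by simple formulas *)

Section Definability.
Variables (L : signature) (K : structure (ord_sig L) -> Prop).
Variable F : forall M : structure L, rel M -> rel M.
Arguments F : clear implicits.
Hypothesis F_natural : natural K F.
Hypotheses (K_hereditary : hereditary K) (K_countable : countably_many_iso_types K).
Implicit Types A B : structure (ord_sig L).

Let G A : rel A := F (reduct A) (@lt_of L A).

Lemma natural_ord A B (h : A -> B) : K A -> K B -> embedding h ->
  forall a b, G (h a) (h b) = G a b.
Proof.
move=> KA KB /embedding_ordP he; apply: (@F_natural (reduct A) (reduct B));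
  rewrite ?expand_lt_of //.
exact/embedding_expandP.
Qed.

Lemma natural_expand (M : structure L) (r : rel M) :
  @G (expand r) = F M r.
Proof. by rewrite /G lt_of_expand; case: M r. Qed.

(** If no simple formula separated a pair where [G] holds from one where it fails, [sat_span] would
    give a common substructure, in [K] by heredity, on which naturality forces the two values of [G]
    to agree. The separating formula for the representatives is then carried along isomorphisms. *)
Lemma natural_definable : exists phi,
  forall (M : structure L) (r : rel M), K (expand r) -> defined_order phi r = F M r.
Proof.
have [E EP] := K_countable.
(* All pairs from all representatives: a countable type, as each [E n] is finite. *)
pose T := {n : nat & (E n * E n)%type}.
pose S (p : T) : structure (ord_sig L) := E (tag p).
pose v (p : T) : 'I_2 -> S p := tnth [tuple (tagged p).1; (tagged p).2].
pose g (p : T) : bool := G (v p ord0) (v p ord_max).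
pose P p := K (S p) /\ g p.
pose Q p := K (S p) /\ ~ g p.
have [|phi [phiP phiQ]] := @separating_formula _ _ T S v P Q ord0.
  move=> p q [Kp gp] [Kq gq]; apply/not_existsP => nsep.
  have [|C [i [j [u [ie je iu ju]]]]] := @sat_span _ _ _ _ (v p) (v q) ord0.
    by move=> psi sp; have [//|sq] := EM (sat (v q) psi); case: (nsep psi).
  apply: gq; move: gp; rewrite /g -!iu -!ju /=.
  have KC : K C by apply: K_hereditary Kp; exists i.
  by rewrite !natural_ord.
exists phi => M r Kr; have [n rE] := EP _ Kr.
have KE : K (E n) := hereditary_iso_closed K_hereditary rE Kr.
have [i ie _] := rE; apply/funext => a; apply/funext => b.
rewrite -natural_expand -(natural_ord Kr KE ie) /defined_order.
pose p : T := Tagged (fun n => (E n * E n)%type) (i a, i b).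
have vE : v p = i \o tnth [tuple a; b].
  by apply/funext; case=> -[|[|//]].
have gE : g p = G (i a) (i b) by rewrite /g vE.
have satE := @sat_embedding _ _ (expand r) (E n) i (tnth [tuple a; b]) phi ie.
rewrite -gE; apply/asboolP/idP => [/satE sp|gp]; last first.
  by apply/satE; have := phiP p (conj KE gp); rewrite vE.
by apply: contrapT => ngp; apply: (phiQ p) => //; rewrite vE.
Qed.

End Definability.

(** * Transfer of properties along a natural bijection *)

Section Transfer.
Variables (L : signature) (K0 : structure L -> Prop).
Variables K' K'' : structure (ord_sig L) -> Prop.
Variable F : forall M : structure L, rel M -> rel M.
Arguments F : clear implicits.
Hypotheses (K0_fraisse : fraisse_class K0).
Hypotheses (K'_fraisse : fraisse_class K') (K'_order : order_class K').
Hypotheses (K'_expansion : expansion_of K0 K') (K'_reasonable : reasonable K0 K').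
Hypotheses (K''_hereditary : hereditary K'') (K''_order : order_class K'').
Hypothesis K''_countable : countably_many_iso_types K''.
Hypothesis K''_reducts : forall A, K'' A -> K0 (reduct A).
Hypotheses (F_natural : natural K'' F) (F_maps : maps_class K'' K' F).
Hypothesis F_onto : forall (M : structure L) (r : rel M), K' (expand r) ->
  exists2 s : rel M, K'' (expand s) & F M s = r.
Hypothesis F_inj : forall (M : structure L) (r s : rel M),
  K'' (expand r) -> K'' (expand s) -> F M r = F M s -> r = s.

(** The inverse is natural because, for [h] from [expand r] to [expand s], the pullback of [G N s]
    along [h] is sent by [F] to [r]; injectivity identifies it with [G M r]. *)
Lemma natural_inverse : exists G : forall M : structure L, rel M -> rel M,
  [/\ natural K' G, maps_class K' K'' G,
      forall (M : structure L) (r : rel M), K'' (expand r) -> G M (F M r) = r &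
      forall (M : structure L) (r : rel M), K' (expand r) -> F M (G M r) = r].
Proof.
have GP (M : structure L) (r : rel M) : exists s : rel M, K' (expand r) ->
    K'' (expand s) /\ F M s = r.
  have [K'r|nK'r] := EM (K' (expand r)); last by exists r.
  by have [s ? ?] := F_onto K'r; exists s.
pose G M r := projT1 (cid (GP M r)).
have G_maps : maps_class K' K'' G.
  by move=> M r K'r; rewrite /G; case: cid => s /= /(_ K'r)[].
have FG (M : structure L) (r : rel M) : K' (expand r) -> F M (G M r) = r.
  by move=> K'r; rewrite /G; case: cid => s /= /(_ K'r)[].
exists G; split=> //; last first.
  move=> M r Kr; apply: F_inj => //; first exact/G_maps/F_maps.
  by rewrite FG //; apply: F_maps.
move=> M N r s h K'r K's /embedding_expandP[he hrs].
have pull_e := embedding_relpre (G N s) he.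
have K''pull : K'' (expand (relpre h (G N s))).
  by apply: K''_hereditary (G_maps _ _ K's); exists h.
suff -> : G M r = relpre h (G N s) by [].
apply: F_inj => //; first exact: G_maps.
rewrite FG //; apply/funext => a; apply/funext => b.
by rewrite -(F_natural K''pull (G_maps _ _ K's) pull_e) FG // hrs.
Qed.

Lemma transfer_bidefinable : simply_bidefinable K0 K'' K'.
Proof.
have [G [G_natural G_maps GF FG]] := natural_inverse.
have [[_ K'_countable _] [K'_hereditary _ _]] := K'_fraisse.
have [phi phiE] := natural_definable F_natural K''_hereditary K''_countable.
have [phi' phi'E] := natural_definable G_natural K'_hereditary K'_countable.
exists phi, phi' => M K0M; split; last first.
  by move=> r K''r; rewrite phiE // phi'E ?GF //; apply: F_maps.
split=> [r K''r|r s|r K'r].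
- by rewrite /expansions /= phiE //; apply: F_maps.
- by rewrite !inE => K''r K''s; rewrite !phiE //; apply: F_inj.
- exists (G M r); first exact: G_maps.
  by rewrite phiE ?FG //; apply: G_maps.
Qed.

(** Joint embedding, amalgamation and reasonableness are solved in [K'] after applying [F], and the
    solution is brought back by [G]. Large members come from expanding large members of [K0]. *)
Lemma transfer_fraisse :
  [/\ fraisse_class K'', order_class K'', expansion_of K0 K'' & reasonable K0 K''].
Proof.
have [G [G_natural G_maps GF FG]] := natural_inverse.
have [_ [_ K'_jep K'_ap]] := K'_fraisse.
have [[_ _ K0_large] _] := K0_fraisse.
have K''_expansion : expansion_of K0 K''.
  split=> // M /K'_expansion.2[r K'r]; exists (G M r); exact: G_maps.
have G_emb (M N : structure L) (r : rel M) (s : rel N) (h : M -> N) :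
    K'' (expand r) -> K' (expand s) ->
    @embedding _ (expand (F M r)) (expand s) h ->
    @embedding _ (expand r) (expand (G N s)) h.
  move=> K''r K's he; have [he0 _] := (embedding_expandP _ _ _).1 he.
  apply/embedding_expandP; split=> // a b.
  by rewrite (G_natural _ _ _ _ _ (F_maps K''r) K's he) GF.
have F_emb (M N : structure L) (r : rel M) (s : rel N) (h : M -> N) :
    K'' (expand r) -> K'' (expand s) -> @embedding _ (expand r) (expand s) h ->
    @embedding _ (expand (F M r)) (expand (F N s)) h.
  move=> K''r K''s he; have [he0 _] := (embedding_expandP _ _ _).1 he.
  by apply/embedding_expandP; split=> //; apply: F_natural.
split=> //; first (split; split=> //).
- exact: hereditary_iso_closed.
- move=> n; have [M K0M nM] := K0_large n.
  by have [r K''r] := K''_expansion.2 M K0M; exists (expand r).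
- elim/expand_ind=> M r; elim/expand_ind=> N s K''r K''s.
  have [C []] := K'_jep _ _ (F_maps K''r) (F_maps K''s).
  elim/expand_ind: C => D t K't [f fe] [g ge].
  exists (expand (G D t)); split; first exact: G_maps.
    by exists f; apply: G_emb.
  by exists g; apply: G_emb.
- elim/expand_ind=> M r; elim/expand_ind=> N s; elim/expand_ind=> P t f g.
  move=> K''r K''s K''t fe ge.
  have [C] := K'_ap (expand (F M r)) (expand (F N s)) (expand (F P t)) f g
    (F_maps K''r) (F_maps K''s) (F_maps K''t)
    (F_emb _ _ _ _ _ K''r K''s fe) (F_emb _ _ _ _ _ K''r K''t ge).
  elim/expand_ind: C => D u [p [q [K'u pe qe pq]]].
  exists (expand (G D u)), p, q; split=> //; first exact: G_maps.
    exact: G_emb.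
  exact: G_emb.
- move=> M N h r K0M K0N he _ K''r.
  have F_lin : linear_order (F M r).
    by have := K'_order (F_maps K''r); rewrite lt_of_expand.
  have [s [_ K's hs]] := K'_reasonable K0M K0N he F_lin (F_maps K''r).
  exists (G N s); split; last exact: G_emb.
    by have := K''_order (G_maps _ _ K's); rewrite lt_of_expand.
  exact: G_maps.
Qed.

End Transfer.

(** * Natural self-maps under the ordering property *)

(* [E] permutes the expansions of each [M]: by the ordering property they all
   occur in a single [E r'], hence, by naturality, as values of [E]; and a
   surjection of a finite set onto itself is injective. *)
Section Coalescence.
Variables (L : signature) (K0 : structure L -> Prop).
Variable K' : structure (ord_sig L) -> Prop.
Variable E : forall M : structure L, rel M -> rel M.
Arguments E : clear implicits.
Hypotheses (K'_hereditary : hereditary K') (K'_expansion : expansion_of K0 K').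
Hypothesis K'_ordering : ordering_property K0 K'.
Hypotheses (E_natural : natural K' E) (E_maps : maps_class K' K' E).

Lemma natural_endomap_onto (M : structure L) (r : rel M) : K' (expand r) ->
  exists2 q : rel M, K' (expand q) & E M q = r.
Proof.
move=> K'r.
have K0M : K0 M by rewrite -(reduct_expand r); exact: K'_expansion.1.
have [N K0N MN] := K'_ordering K0M.
have [s K's] := K'_expansion.2 N K0N.
have [h /embedding_expandP[he hs]] := MN r (E N s) K'r (E_maps K's).
pose q : rel M := relpre h s; have pull_e := embedding_relpre s he.
have K'q : K' (expand q) by apply: K'_hereditary K's; exists h.
exists q => //; apply/funext => a; apply/funext => b.
by rewrite -hs (E_natural K'q K's pull_e).
Qed.

Lemma natural_endomap_inj (M : structure L) (r s : rel M) :
  K' (expand r) -> K' (expand s) -> E M r = E M s -> r = s.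
Proof.
(* Relations are coded as finite functions, so that expansions of [M] can be counted. *)
pose unc (r : rel M) := [ffun p : M * M => r p.1 p.2].
pose cur (f : {ffun M * M -> bool}) : rel M := fun a b => f (a, b).
have uncK : cancel unc cur.
  by move=> q; apply/funext => a; apply/funext => b; rewrite /cur ffunE.
pose X := [set f | `[< K' (expand (cur f)) >]].
pose e f := unc (E M (cur f)).
have Xe : X \subset e @: X.
  apply/fintype.subsetP => f; rewrite inE => /asboolP/natural_endomap_onto[q K'q Eq].
  apply/imsetP; exists (unc q); first by rewrite inE uncK; apply/asboolP.
  by rewrite /e uncK Eq; apply/ffunP => -[a b]; rewrite ffunE.
have /imset_injP e_inj : #|e @: X| == #|X|.
  by rewrite eqn_leq leq_imset_card subset_leq_card.
move=> K'r K's Ers; apply: (can_inj uncK); apply: e_inj.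
- by rewrite inE uncK; apply/asboolP.
- by rewrite inE uncK; apply/asboolP.
- by rewrite /e !uncK Ers.
Qed.

End Coalescence.

(** * Construction of the subclass *)

Unset Implicit Arguments.

Theorem theorem9p5 (L0 : signature)
    (K0 : structure L0 -> Prop) (K K' : structure (ord_sig L0) -> Prop)
    (K0_fraisse : fraisse_class K0)
    (K_fraisse : fraisse_class K) (K_order : order_class K)
    (K_expansion : expansion_of K0 K) (K_reasonable : reasonable K0 K)
    (K'_fraisse : fraisse_class K') (K'_order : order_class K')
    (K'_expansion : expansion_of K0 K') (K'_reasonable : reasonable K0 K')
    (K_ramsey : ramsey_property K)
    (K'_ramsey : ramsey_property K')
    (K'_ordering : ordering_property K0 K') :
  exists K'' : structure (ord_sig L0) -> Prop,
    [/\ fraisse_class K'', order_class K'', expansion_of K0 K'' &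
        reasonable K0 K''] /\
    (forall A : structure (ord_sig L0), K'' A -> K A) /\
    simply_bidefinable K0 K'' K'.
Proof.
have [K_her K'_her] := (K_ramsey.1, K'_ramsey.1).
have [F [F_nat F_maps]] := natural_map_exists K_fraisse K_order K_expansion
  K_ramsey K'_her K'_expansion.
have [H [H_nat H_maps]] := natural_map_exists K'_fraisse K'_order K'_expansion
  K'_ramsey K_her K_expansion.
pose E M r := F M (H M r).
have E_maps : maps_class K' K' E by move=> M r K'r; apply/F_maps/H_maps.
have H_emb (M N : structure L0) (r : rel M) (s : rel N) (h : M -> N) :
    K' (expand r) -> K' (expand s) -> @embedding _ (expand r) (expand s) h ->
    @embedding _ (expand (H M r)) (expand (H N s)) h.
  move=> K'r K's he; apply/embedding_expandP; split; last exact: H_nat.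
  by case/embedding_expandP: he.
have E_nat : natural K' E.
  move=> M N r s h K'r K's he; apply: F_nat; try exact: H_maps.
  exact: H_emb.
have E_onto := natural_endomap_onto K'_her K'_expansion K'_ordering E_nat E_maps.
have E_inj := natural_endomap_inj K'_her K'_expansion K'_ordering E_nat E_maps.
pose K'' (A : structure (ord_sig L0)) := exists2 r : rel A,
  K' (@expand L0 (reduct A) r) & H (reduct A) r = @lt_of L0 A.
have K''P (M : structure L0) (s : rel M) :
    K'' (expand s) <-> exists2 r : rel M, K' (expand r) & H M r = s.
  by rewrite /K'' lt_of_expand; case: M s.
have K''K A : K'' A -> K A.
  elim/expand_ind: A => M s /K''P[r K'r <-]; exact: H_maps.
have K''_nat : natural K'' F by move=> M N r s h /K''K Kr /K''K Ks; apply: F_nat.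
have K''_maps : maps_class K'' K' F by move=> M r /K''K; apply: F_maps.
have K''_her : hereditary K''.
  elim/expand_ind=> M r; elim/expand_ind=> N t [h /embedding_expandP[he hr]].
  move=> /K''P[s K's Hs].
  (* A substructure of an [H]-value is the [H]-value of the restricted order, by naturality of
     [H]. *)
  pose q : rel M := relpre h s; have pull_e := embedding_relpre s he.
  have K'q : K' (expand q) by apply: K'_her K's; exists h.
  apply/K''P; exists q => //; apply/funext => a; apply/funext => b.
  by rewrite -(H_nat _ _ _ _ _ K'q K's pull_e) -hr Hs.
have K''_onto (M : structure L0) (r : rel M) : K' (expand r) ->
    exists2 s : rel M, K'' (expand s) & F M s = r.
  by move=> /E_onto[q K'q Eq]; exists (H M q) => //; apply/K''P; exists q.
have K''_inj (M : structure L0) (r s : rel M) :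
    K'' (expand r) -> K'' (expand s) -> F M r = F M s -> r = s.
  (* On [H]-values, equality under [F] is equality under [E], which is injective. *)
  by move=> /K''P[q K'q <-] /K''P[t K't <-] /E_inj->.
have K''_ord : order_class K'' by move=> A /K''K/K_order.
have K''_count : countably_many_iso_types K''.
  by have [[_ [X XP] _] _] := K_fraisse; exists X => A /K''K/XP.
have K''_red A : K'' A -> K0 (reduct A) by move=> /K''K/K_expansion.1.
exists K''; split; last split=> //.
  exact: (@transfer_fraisse L0 K0 K' K'' F).
exact: (@transfer_bidefinable L0 K0 K' K'' F).
Qed.
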